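(* Let $h(z) = z + \sum_{k=2}^\infty a_k z^k$ be analytic in a neighbourhood of the origin, and let the complex-valued harmonic function $$f(z) = h(z) - \overline{z} = z + \sum_{k=2}^\infty a_k z^k - \overline{z}$$ have an isolated singular zero at the origin. Let $n \geq 2$ be the smallest index with $a_n \neq 0$. Then $$\mathrm{ind}(f; 0) = \begin{cases} 0 & \text{if } \mathrm{Re}(a_n) \neq 0 \text{ and } n \text{ is even}, \\ +1 & \text{if } \mathrm{Re}(a_n) > 0 \text{ and } n \text{ is odd}, \\ -1 & \text{if } \mathrm{Re}(a_n) < 0 \text{ and } n \text{ is odd}. \end{cases}$$
   Context: For $f(z) = h(z) - \overline{z}$ with $h$ analytic, a zero $z_0$ of $f$ is called singular if $|h'(z_0)| = 1$. Winding: for a curve $\Gamma$ parametrized by a continuous $\gamma : [a,b] \to \mathbb{C}$ and a continuous function $f : \Gamma \to \mathbb{C}$ without zeros on $\Gamma$, the winding of $f$ on $\Gamma$ is $V(f;\Gamma) = \frac{1}{2\pi}[\arg(f(\gamma(b))) - \arg(f(\gamma(a)))]$, where $\arg(f\circ\gamma)$ is a continuous branch of the argument along $\gamma$. Poincaré index: if $f$ is continuous and nonzero in a punctured disk $\{z : 0 < |z - z_0| < R\}$, then $\mathrm{ind}(f; z_0) := V(f; \Gamma_r)\in\mathbb{Z}$, where $0 < r < R$ and $\Gamma_r$ is the positively oriented circle with center $z_0$ and radius $r$ (the value does not depend on $r$). *)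

(* Defs.v *)
From Stdlib Require Import Reals.
From Coquelicot Require Import Coquelicot.
Open Scope R_scope.

Definition harmonic_of (h : C -> C) (z : C) : C := (h z - Cconj z)%C.

(* [h] is the sum of the power series with coefficients [a] on a disk around
   the origin; [is_pseries] is taken over the complex field. *)
Definition has_expansion_at_0 (h : C -> C) (a : nat -> C) : Prop :=
  exists rho : R, 0 < rho /\
    forall z : C, Cmod z < rho ->
      is_pseries (K := C_AbsRing) (V := C_NormedModule) a z (h z).

Definition isolated_zero (f : C -> C) (z0 : C) : Prop :=
  f z0 = RtoC 0 /\
  exists rho : R, 0 < rho /\
    forall z : C, 0 < Cmod (z - z0) < rho -> f z <> RtoC 0.

Definition singular_zero (h : C -> C) (z0 : C) : Prop :=
  harmonic_of h z0 = RtoC 0 /\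
  exists d : C,
    is_derive (K := C_AbsRing) (V := C_NormedModule) h z0 d /\ Cmod d = 1.

(* [theta] is a continuous branch of arg (g t) for t in [a, b]. *)
Definition arg_branch (g : R -> C) (a b : R) (theta : R -> R) : Prop :=
  continuous_on (fun t => a <= t <= b) theta /\
  forall t : R, a <= t <= b ->
    g t = (RtoC (Cmod (g t)) * (cos (theta t), sin (theta t)))%C.

(* V(f; gamma) is defined and equals [v]. *)
Definition is_winding (f : C -> C) (gamma : R -> C) (a b v : R) : Prop :=
  a <= b /\
  continuous_on (fun t => a <= t <= b) gamma /\
  continuous_on (fun z => exists t, a <= t <= b /\ z = gamma t) f /\
  (forall t : R, a <= t <= b -> f (gamma t) <> RtoC 0) /\
  exists theta : R -> R,
    arg_branch (fun t => f (gamma t)) a b theta /\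
    v = / (2 * PI) * (theta b - theta a).

Definition circle (z0 : C) (r : R) (t : R) : C :=
  (z0 + RtoC r * (cos t, sin t))%C.

(* ind(f; z0) is defined and equals [k]; the independence of the radius of the
   circle is part of the definition. *)
Definition is_index (f : C -> C) (z0 : C) (k : Z) : Prop :=
  exists rho : R, 0 < rho /\
    (forall z : C, 0 < Cmod (z - z0) < rho -> continuous f z /\ f z <> RtoC 0) /\
    forall r : R, 0 < r < rho ->
      is_winding f (circle z0 r) 0 (2 * PI) (IZR k).

(* Main.v *)
(** On the circle [z = r exp (i t)] write [h z = z + z^n k] with
    [k = a_n + O(r)], so that
    [Re (f z) = r^n (Re a_n cos^n t + O(|sin t|) + O(r))] and
    [Im (f z) = 2 r sin t + O(r^n)].  Hence [f z] stays in the open half plane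
    around the direction [(e t, sin t)], where [e] is [1], [-1], [cos] or
    [- cos] and has the sign of [Re a_n cos^n t] at [t = 0] and [t = PI].
    The argument of [f z] is therefore that of the model vector
    [(e t, sin t)] plus an arc tangent, which is periodic, and the index is the
    winding number [0], [0], [1] or [-1] of the model. *)

Require Import Defs.
From Stdlib Require Import Reals Lra Lia.
From Coquelicot Require Import Coquelicot.
Open Scope R_scope.

(** * Estimates for complex power series *)

Lemma Im_le_Cmod (z : C) : Rabs (Im z) <= Cmod z.
Proof. exact (Rle_trans _ _ _ (Rmax_r _ _) (Rmax_Cmod z)). Qed.

Lemma pow_n_Cpow (z : C) (k : nat) : pow_n (K := C_Ring) z k = (z ^ k)%C.
Proof. induction k as [|k IH]; [reflexivity|]. simpl. rewrite IH. reflexivity. Qed.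

(** Telescoping: [z^(k+2) - w^(k+2) = z (z^(k+1) - w^(k+1)) + (z - w) w^(k+1)]. It serves both for
    the terms of a power series and for comparing [exp (i t)^n] with [cos t ^ n]. *)
Lemma Cmod_pow_minus (R0 : R) (z w : C) (k : nat) :
  Cmod z <= R0 -> Cmod w <= R0 ->
  Cmod (z ^ S k - w ^ S k) <= INR (S k) * R0 ^ k * Cmod (z - w).
Proof.
  intros Hz Hw.
  pose proof (Cmod_ge_0 z). pose proof (Cmod_ge_0 w). pose proof (Cmod_ge_0 (z - w)).
  induction k as [|k IH].
  - simpl. replace (z * 1 - w * 1)%C with (z - w)%C by ring. lra.
  - replace (z ^ S (S k) - w ^ S (S k))%C
      with (z * (z ^ S k - w ^ S k) + (z - w) * w ^ S k)%C
      by (rewrite !Cpow_S; ring).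
    eapply Rle_trans; [apply Cmod_triangle|].
    rewrite !Cmod_mult, Cmod_pow, (S_INR (S k)).
    assert (Cmod w ^ S k <= R0 ^ S k) by (apply pow_incr; lra).
    assert (Cmod z * Cmod (z ^ S k - w ^ S k)
            <= R0 * (INR (S k) * R0 ^ k * Cmod (z - w)))
      by (apply Rmult_le_compat; auto using Cmod_ge_0).
    assert (Cmod (z - w) * Cmod w ^ S k <= Cmod (z - w) * R0 ^ S k)
      by (apply Rmult_le_compat_l; auto).
    simpl pow in *. lra.
Qed.

(** The convergent partial sums are bounded, and each term after the first is the difference of two
    consecutive ones, whence the factor 2. *)
Lemma is_pseries_terms_bounded (a : nat -> C) (z l : C) :
  is_pseries (K := C_AbsRing) (V := C_NormedModule) a z l ->
  exists M : R, 0 <= M /\ forall k, Cmod (a k) * Cmod z ^ k <= M.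
Proof.
  intros Hs.
  destruct (filterlim_bounded (K := C_AbsRing) (V := C_NormedModule) _
              (ex_intro _ l Hs)) as [M HM].
  set (t := fun k : nat => scal (pow_n (K := C_AbsRing) z k) (a k)) in HM.
  assert (Ht : forall k, Cmod (a k) * Cmod z ^ k = Cmod (t k)).
  { intros k. unfold t. change (Cmod (a k) * Cmod z ^ k = Cmod (pow_n (K := C_Ring) z k * a k)).
    rewrite pow_n_Cpow, Cmod_mult, Cmod_pow. ring. }
  assert (HM' : forall k, Cmod (sum_n t k) <= M)
    by exact HM.
  exists (2 * M). split.
  - pose proof (HM' 0%nat). pose proof (Cmod_ge_0 (sum_n t 0)). lra.
  - intros k. rewrite Ht. pose proof (HM' k) as Hk. destruct k as [|k].
    + rewrite sum_O in Hk. pose proof (Cmod_ge_0 (t 0%nat)). lra.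
    + pose proof (HM' k) as Hk'. rewrite sum_Sn in Hk.
      change (Cmod (sum_n t k + t (S k))%C <= M) in Hk.
      replace (t (S k)) with ((sum_n t k + t (S k)) + - sum_n t k)%C by ring.
      eapply Rle_trans; [apply Cmod_triangle|]. rewrite Cmod_opp. lra.
Qed.

(** Since [|a_k| rho^k <= M], on the disk of half radius the [k]-th terms at [z] and [w] differ by
    at most [(M / rho) k 2^(1-k) |z - w|], and the numbers [k 2^(1-k)] sum to 4. This gives both the
    continuity of [h] and the estimate [a_n + O(r)] for its leading coefficient. *)
Lemma is_pseries_lipschitz (a : nat -> C) (rho : R) (l : C) :
  0 < rho ->
  is_pseries (K := C_AbsRing) (V := C_NormedModule) a (RtoC rho) l ->
  exists L : R, 0 <= L /\ forall z w u v : C,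
    Cmod z <= rho / 2 -> Cmod w <= rho / 2 ->
    is_pseries (K := C_AbsRing) (V := C_NormedModule) a z u ->
    is_pseries (K := C_AbsRing) (V := C_NormedModule) a w v ->
    Cmod (u - v) <= L * Cmod (z - w).
Proof.
  intros Hrho Hl.
  destruct (is_pseries_terms_bounded _ _ _ Hl) as [M [M0 HM]].
  rewrite Cmod_R, Rabs_pos_eq in HM by lra.
  exists (4 * M / rho).
  assert (HL : 0 <= 4 * M / rho) by (apply Rdiv_le_0_compat; lra).
  split; [exact HL|].
  intros z w u v Hz Hw Hu Hv.
  pose proof (is_series_minus _ _ _ _ Hu Hv) as Hd.
  set (t := fun k : nat => plus (scal (pow_n (K := C_AbsRing) z k) (a k))
                     (opp (scal (pow_n (K := C_AbsRing) w k) (a k)))) in Hd.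
  assert (Ht : forall k, t k = (a k * (z ^ k - w ^ k))%C).
  { intros k. rewrite <- !pow_n_Cpow.
    change ((pow_n (K := C_Ring) z k * a k + - (pow_n (K := C_Ring) w k * a k))%C
            = (a k * (pow_n (K := C_Ring) z k - pow_n (K := C_Ring) w k))%C). ring. }
  set (d := Cmod (z - w)).
  assert (d0 : 0 <= d) by apply Cmod_ge_0.
  assert (Hterm : forall k, Cmod (t (S k)) <= M / rho * d * (INR (S k) * (/ 2) ^ k)).
  { intros k. rewrite Ht, Cmod_mult.
    pose proof (Cmod_pow_minus (rho / 2) z w k Hz Hw) as Hp.
    pose proof (HM (S k)) as Hk.
    eapply Rle_trans; [apply Rmult_le_compat_l; [apply Cmod_ge_0|exact Hp]|].
    fold d. unfold Rdiv. rewrite Rpow_mult_distr.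
    replace (Cmod (a (S k)) * (INR (S k) * (rho ^ k * (/ 2) ^ k) * d))
      with ((Cmod (a (S k)) * rho ^ S k) * (/ rho * d * (INR (S k) * (/ 2) ^ k)))
      by (simpl pow; field; lra).
    replace (M * / rho * d * (INR (S k) * (/ 2) ^ k))
      with (M * (/ rho * d * (INR (S k) * (/ 2) ^ k))) by ring.
    apply Rmult_le_compat_r; [|exact Hk].
    repeat apply Rmult_le_pos; auto using pos_INR.
    - left. now apply Rinv_0_lt_compat.
    - apply pow_le; lra. }
  (* The bracket is the closed form of the sum of [k 2^(1-k)] for [k] from 1 to [N]; the term of
     index 0 cancels. *)
  assert (Hsum : forall N, Cmod (sum_n t N) <= M / rho * d * (4 - (2 * INR N + 4) * (/ 2) ^ N)).
  { induction N as [|N IH].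
    - rewrite sum_O, Ht. simpl. rewrite Cmod_mult.
      replace (1 - 1)%C with (RtoC 0) by ring. rewrite Cmod_0. lra.
    - rewrite sum_Sn. change (Cmod (sum_n t N + t (S N))%C
        <= M / rho * d * (4 - (2 * INR (S N) + 4) * (/ 2) ^ S N)).
      eapply Rle_trans; [apply Cmod_triangle|].
      eapply Rle_trans; [apply Rplus_le_compat; [exact IH|apply Hterm]|].
      rewrite S_INR. simpl pow. right. field. lra. }
  (* The bound on partial sums passes to the limit by continuity of the norm. *)
  change (Rbar_le (Cmod (u - v)) (4 * M / rho * d)).
  apply (filterlim_le (F := eventually) (fun N => Cmod (sum_n t N)) (fun _ => 4 * M / rho * d)).
  - exists 0%nat. intros N _. eapply Rle_trans; [apply Hsum|].
    replace (4 * M / rho * d) with (M / rho * d * 4) by (field; lra).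
    apply Rmult_le_compat_l.
    + apply Rmult_le_pos; [apply Rdiv_le_0_compat; lra|exact d0].
    + pose proof (pow_le (/2) N ltac:(lra)). pose proof (pos_INR N). nra.
  - apply (filterlim_comp _ _ _ (sum_n t) Cmod _ (locally (u - v)%C)).
    + exact Hd.
    + exact (filterlim_norm (K := C_AbsRing) (V := C_NormedModule) (u - v)%C).
  - apply filterlim_const.
Qed.

(** * Continuity along circles and winding numbers from a direction *)

Lemma continuous_C_pair {U : UniformSpace} (x y : U -> R) (u : U) :
  continuous x u -> continuous y u -> continuous (fun s => (x s, y s) : C) u.
Proof.
  intros Hx Hy.
  apply (continuous_comp_2 x y (fun p q => (p, q) : C) u Hx Hy).
  apply continuous_ext with (f := fun z : R * R => z); [now intros [p q]|].
  apply continuous_id.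
Qed.

Lemma continuous_circle (z0 : C) (r t : R) : continuous (circle z0 r) t.
Proof.
  apply continuous_ext
    with (f := fun t => (Re z0 + r * cos t, Im z0 + r * sin t) : C).
  { intros s. unfold circle, Re, Im. apply injective_projections; simpl; ring. }
  apply continuous_C_pair.
  - apply (continuous_plus (V := R_NormedModule)); [apply continuous_const|].
    apply (continuous_scal_r (V := R_NormedModule)), continuous_cos.
  - apply (continuous_plus (V := R_NormedModule)); [apply continuous_const|].
    apply (continuous_scal_r (V := R_NormedModule)), continuous_sin.
Qed.

Lemma continuous_continuous_on_all {T U : UniformSpace} (D : T -> Prop) (g : T -> U) :
  (forall x, D x -> continuous g x) -> continuous_on D g.
Proof.
  intros Hg x Hx. apply filterlim_filter_le_1 with (2 := Hg x Hx).
  apply filter_le_within.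
Qed.

(* The rotated vector [exp (- i phi) w] has positive real part, so [atan] gives
   the deviation of [arg w] from [phi]. *)
Lemma polar_of_direction (w : C) (phi : R) :
  let P := Re w * cos phi + Im w * sin phi in
  let Q := Im w * cos phi - Re w * sin phi in
  0 < P ->
  w = (RtoC (Cmod w) * (cos (phi + atan (Q / P)), sin (phi + atan (Q / P))))%C.
Proof.
  intros P Q HP.
  assert (Hcs : cos phi * cos phi + sin phi * sin phi = 1)
    by (pose proof (sin2_cos2 phi) as E; unfold Rsqr in E; lra).
  (* Rotation preserves the modulus: [|w|^2 = P^2 + Q^2]. *)
  assert (Hm : Cmod w = P * sqrt (1 + (Q / P)²)).
  { unfold Cmod. rewrite <- (sqrt_Rsqr P) at 1 by lra.
    rewrite <- sqrt_mult by (try apply Rle_0_sqr; pose proof (Rle_0_sqr (Q / P)); lra).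
    f_equal. transitivity (P² + Q²).
    - unfold P, Q, Re, Im, Rsqr.
      transitivity ((fst w * fst w + snd w * snd w) * (cos phi * cos phi + sin phi * sin phi));
        [rewrite Hcs|]; ring.
    - unfold Rsqr. field. lra. }
  rewrite cos_plus, sin_plus, cos_atan, sin_atan, Hm.
  assert (Hs : 0 < sqrt (1 + (Q / P)²))
    by (apply sqrt_lt_R0; pose proof (Rle_0_sqr (Q / P)); lra).
  set (s := sqrt (1 + (Q / P)²)) in *.
  apply injective_projections; simpl.
  - transitivity (P * cos phi - Q * sin phi); [|field; lra].
    unfold P, Q, Re, Im.
    transitivity (fst w * (cos phi * cos phi + sin phi * sin phi)); [rewrite Hcs|]; ring.
  - transitivity (P * sin phi + Q * cos phi); [|field; lra].
    unfold P, Q, Re, Im.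
    transitivity (snd w * (cos phi * cos phi + sin phi * sin phi)); [rewrite Hcs|]; ring.
Qed.

(** The branch is [phi] plus the arc tangent of the deviation from it. That correction depends only
    on [f (gamma t)] and on the cosine and sine of [phi t], so it agrees at both ends and drops out
    of the winding. *)
Lemma is_winding_of_direction (f : C -> C) (gamma : R -> C) (a b : R) (phi : R -> R) :
  a <= b ->
  (forall t, continuous gamma t) ->
  (forall t, continuous f (gamma t)) ->
  (forall t, continuous phi t) ->
  (forall t, 0 < Re (f (gamma t)) * cos (phi t) + Im (f (gamma t)) * sin (phi t)) ->
  gamma a = gamma b -> cos (phi a) = cos (phi b) -> sin (phi a) = sin (phi b) ->
  is_winding f gamma a b (/ (2 * PI) * (phi b - phi a)).
Proof.
  intros Hab Hg Hf Hphi Hpos Eg Ec Es.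
  repeat split; auto.
  - apply continuous_continuous_on_all; auto.
  - apply continuous_continuous_on_all. intros z [t [_ ->]]. apply Hf.
  - intros t _ E. specialize (Hpos t). rewrite E in Hpos. simpl in Hpos. lra.
  - set (P := fun t => Re (f (gamma t)) * cos (phi t) + Im (f (gamma t)) * sin (phi t)).
    set (Q := fun t => Im (f (gamma t)) * cos (phi t) - Re (f (gamma t)) * sin (phi t)).
    exists (fun t => phi t + atan (Q t / P t)). repeat split.
    + apply continuous_continuous_on_all. intros t _.
      assert (HF : continuous (fun t => f (gamma t)) t) by (apply continuous_comp; auto).
      assert (Hx : continuous (fun t => Re (f (gamma t))) t).
      { apply (continuous_comp (fun t => f (gamma t)) Re); [exact HF|].
        unfold Re. destruct (f (gamma t)). apply continuous_fst. }
      assert (Hy : continuous (fun t => Im (f (gamma t))) t).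
      { apply (continuous_comp (fun t => f (gamma t)) Im); [exact HF|].
        unfold Im. destruct (f (gamma t)). apply continuous_snd. }
      assert (Hc : continuous (fun t => cos (phi t)) t) by (apply continuous_cos_comp; auto).
      assert (Hs : continuous (fun t => sin (phi t)) t) by (apply continuous_sin_comp; auto).
      apply (continuous_plus (V := R_NormedModule)); [apply Hphi|].
      apply continuous_atan_comp.
      apply (continuous_mult (K := R_AbsRing)).
      * apply (continuous_minus (V := R_NormedModule));
          apply (continuous_mult (K := R_AbsRing)); assumption.
      * apply continuous_Rinv_comp; [|apply Rgt_not_eq, Hpos].
        apply (continuous_plus (V := R_NormedModule));
          apply (continuous_mult (K := R_AbsRing)); assumption.
    + intros t _. apply polar_of_direction, Hpos.
    + replace (Q b) with (Q a) by (unfold Q; now rewrite Eg, Ec, Es).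
      replace (P b) with (P a) by (unfold P; now rewrite Eg, Ec, Es).
      f_equal. ring.
Qed.

(** * Leading term of the expansion and positivity along the model direction *)

Lemma pow_le_antitone (x : R) (i j : nat) : 0 <= x <= 1 -> (i <= j)%nat -> x ^ j <= x ^ i.
Proof.
  intros Hx Hij. replace j with (i + (j - i))%nat by lia. rewrite pow_add.
  pose proof (pow_le x i ltac:(lra)).
  pose proof (pow_incr x 1 (j - i) Hx) as H1. rewrite pow1 in H1. nra.
Qed.

Lemma bernoulli_minus (x : R) (n : nat) : 0 <= x <= 1 -> 1 - INR n * x <= (1 - x) ^ n.
Proof.
  intros Hx. induction n as [|n IH]; [simpl; lra|].
  rewrite S_INR. simpl. pose proof (pow_incr (1 - x) 1 n ltac:(lra)) as H1.
  rewrite pow1 in H1. nra.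
Qed.

(** The factor [k] is [(h z - z) / z^n], the sum of the series shifted by [n]. Its value at 0 is
    [a n], so the Lipschitz bound between [z] and 0 yields the error [L |z|]. *)
Lemma has_expansion_leading_term (h : C -> C) (a : nat -> C) (n : nat) :
  has_expansion_at_0 h a ->
  a 0%nat = RtoC 0 -> a 1%nat = RtoC 1 -> (2 <= n)%nat ->
  (forall k : nat, (2 <= k < n)%nat -> a k = RtoC 0) ->
  exists rho L : R, 0 < rho /\ 0 <= L /\
    (forall z, Cmod z < rho -> continuous h z) /\
    forall z, 0 < Cmod z < rho -> exists k : C,
      h z = (z + z ^ n * k)%C /\ Cmod (k - a n) <= L * Cmod z.
Proof.
  intros [rho0 [Hrho0 Hser]] a0 a1 Hn Hmin.
  set (rho1 := rho0 / 2).
  assert (Hrho1 : 0 < rho1 < rho0) by (unfold rho1; lra).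
  assert (Hconv : forall z, z <> RtoC 0 -> Cmod z < rho0 ->
    is_pseries (K := C_AbsRing) (V := C_NormedModule) (PS_decr_n a n) z
      ((/ z) ^ n * (h z - z))%C).
  { intros z Hz Hzr.
    pose proof (is_pseries_decr_n (K := C_AbsRing) (V := C_NormedModule)
      a n z (/ z)%C (h z) (Cinv_l z Hz) ltac:(lia) (Hser z Hzr)) as Hd.
    (* All partial sums of order from 1 to [n - 1] equal [z], because only [a 1] contributes. *)
    assert (Hsum : forall m, (S m < n)%nat ->
      sum_n (fun k : nat => scal (pow_n (K := C_AbsRing) z k) (a k) : C_NormedModule) (S m) = z).
    { induction m as [|m IH]; intros Hm.
      - rewrite sum_Sn, sum_O.
        change ((1 * a 0%nat + z * 1 * a 1%nat)%C = z). rewrite a0, a1. ring.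
      - rewrite sum_Sn, IH by lia. rewrite (Hmin (S (S m))) by lia.
        change ((z + pow_n (K := C_Ring) z (S (S m)) * 0)%C = z). ring. }
    replace (n - 1)%nat with (S (n - 2)) in Hd by lia.
    rewrite Hsum in Hd by lia.
    rewrite <- pow_n_Cpow. exact Hd. }
  assert (Hm1 : Cmod (RtoC rho1) < rho0) by (rewrite Cmod_R, Rabs_pos_eq; lra).
  assert (Hne1 : RtoC rho1 <> RtoC 0) by (intros E; apply RtoC_inj in E; lra).
  destruct (is_pseries_lipschitz a rho1 _ (proj1 Hrho1) (Hser _ Hm1)) as [L1 [HL1 Hlip1]].
  destruct (is_pseries_lipschitz _ rho1 _ (proj1 Hrho1) (Hconv _ Hne1 Hm1)) as [L [HL Hlip]].
  exists (rho1 / 2), L. split; [lra|]. split; [exact HL|]. split.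
  - intros z Hz.
    apply (filterlim_locally (F := locally z) (U := C_UniformSpace) h (h z)). intros eps.
    (* Balls of [C] are products of intervals, so a ball of radius [d] only gives
       [|w - z| < sqrt 2 d]; the final halving absorbs this factor. [L1 + 1] keeps the denominator
       positive. *)
    set (d := Rmin (rho1 / 2 - Cmod z) (eps / (L1 + 1)) / 2).
    assert (He : 0 < eps / (L1 + 1)) by (apply Rdiv_lt_0_compat; [apply cond_pos|lra]).
    assert (Hd : 0 < d) by (unfold d; apply Rdiv_lt_0_compat; [apply Rmin_pos; [lra|exact He]|lra]).
    exists (mkposreal d Hd). intros w Hw.
    apply C_NormedModule_mixin_compat2 in Hw. simpl in Hw.
    assert (Hzw : Cmod (w - z) < 2 * d).
    { eapply Rlt_le_trans; [exact Hw|]. apply Rmult_le_compat_r; [lra|].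
      left. apply sqrt_less; lra. }
    assert (Hd1 : 2 * d <= rho1 / 2 - Cmod z)
      by (unfold d; pose proof (Rmin_l (rho1 / 2 - Cmod z) (eps / (L1 + 1))); lra).
    assert (Hd2 : 2 * d <= eps / (L1 + 1))
      by (unfold d; pose proof (Rmin_r (rho1 / 2 - Cmod z) (eps / (L1 + 1))); lra).
    assert (Hw' : Cmod w < rho1 / 2).
    { replace w with (z + (w - z))%C by ring.
      pose proof (Cmod_triangle z (w - z)). lra. }
    apply (C_NormedModule_mixin_compat1 (h z) (h w) eps).
    apply Rle_lt_trans with (L1 * Cmod (w - z)).
    + apply (Hlip1 w z); try lra; apply Hser; lra.
    + apply Rle_lt_trans with (L1 * (eps / (L1 + 1))).
      * apply Rmult_le_compat_l; lra.
      * replace (pos eps) with ((L1 + 1) * (eps / (L1 + 1))) at 2 by (field; lra). nra.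
  - intros z Hz. exists ((/ z) ^ n * (h z - z))%C.
    assert (Hz0 : z <> RtoC 0) by (apply Cmod_gt_0; lra).
    split.
    + rewrite Cpow_inv by exact Hz0. field. now apply Cpow_nz.
    + replace (L * Cmod z) with (L * Cmod (z - 0)) by (do 2 f_equal; ring).
      apply Hlip; [lra|rewrite Cmod_0; lra|apply Hconv; [exact Hz0|lra]|].
      replace (a n) with (PS_decr_n a n 0) by (unfold PS_decr_n; f_equal; lia).
      apply (is_pseries_0 (K := C_AbsRing) (V := C_NormedModule) (PS_decr_n a n)).
Qed.

(* Dividing by [r], the quantity is at least
   [r^(n-1) (|Re an| - E |sin t| - L r) + 2 sin^2 t], and [r^(n-1) <= r] lets
   AM-GM absorb the term in [|sin t|]. *)
Lemma harmonic_direction_positive (h : C -> C) (an : C) (n : nat) (rho L : R) :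
  0 < rho -> 0 <= L -> (2 <= n)%nat -> Re an <> 0 ->
  (forall z, 0 < Cmod z < rho -> exists k : C,
      h z = (z + z ^ n * k)%C /\ Cmod (k - an) <= L * Cmod z) ->
  exists r0 : R, 0 < r0 <= rho /\
    forall r t e : R, 0 < r < r0 -> Rabs e <= 1 ->
      Rabs (Re an) * (cos t ^ 2) ^ n <= Re an * cos t ^ n * e ->
      0 < Re (harmonic_of h (circle 0 r t)) * e
          + Im (harmonic_of h (circle 0 r t)) * sin t.
Proof.
  intros Hrho HL Hn Hre Hexp.
  set (al := Rabs (Re an)). set (A := Cmod an).
  assert (Hal : 0 < al) by now apply Rabs_pos_lt.
  assert (HA : 0 <= A) by apply Cmod_ge_0.
  (* [D] is the cost, per [|sin t|], of replacing [exp (i t)^n] by [cos t ^ n]. [E] collects all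
     coefficients of [|sin t|]: [n |Re an|] from Bernoulli, [D] from the real part, [A + L] from the
     imaginary part. [K] is what AM-GM then leaves as coefficient of [r], plus 1 to make it
     positive. *)
  set (D := INR n * (A + L)).
  assert (HD : 0 <= D) by (apply Rmult_le_pos; [apply pos_INR|lra]).
  set (E := INR n * al + D + A + L).
  assert (HE : 0 <= E)
    by (unfold E; pose proof (Rmult_le_pos _ _ (pos_INR n) (Rlt_le _ _ Hal)); lra).
  set (K := E * E / 4 + L + 1).
  assert (HK : 0 < K) by (unfold K; nra).
  exists (Rmin rho (Rmin 1 (al / K))). split.
  { split; [|apply Rmin_l]. repeat apply Rmin_pos; try lra. now apply Rdiv_lt_0_compat. }
  intros r t e [Hr0 Hr] He Hdir.
  assert (Hr1 : r < rho) by (eapply Rlt_le_trans; [exact Hr|apply Rmin_l]).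
  pose proof (Rlt_le_trans _ _ _ Hr (Rmin_r _ _)) as Hr'.
  assert (Hr2 : r < 1) by (eapply Rlt_le_trans; [exact Hr'|apply Rmin_l]).
  assert (Hr3 : r * K < al).
  { pose proof (Rlt_le_trans _ _ _ Hr' (Rmin_r _ _)) as H.
    apply (Rmult_lt_compat_r K) in H; [|exact HK].
    replace (al / K * K) with al in H by (field; lra). exact H. }
  clear Hr Hr'.
  set (c := cos t) in *. set (s := sin t).
  assert (Hcs : c ^ 2 = 1 - s * s)
    by (pose proof (sin2_cos2 t) as Q; unfold Rsqr in Q; fold c s in Q; simpl; lra).
  assert (Hs2 : 0 <= s * s <= 1) by nra.
  set (u := (c, s) : C).
  assert (Hu : Cmod u = 1)
    by (unfold Cmod, u; simpl fst; simpl snd; rewrite <- sqrt_1; f_equal; simpl in *; lra).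
  assert (Hcirc : circle 0 r t = (RtoC r * u)%C) by (unfold circle; fold c s u; ring).
  assert (Hzr : Cmod (RtoC r * u) = r)
    by (rewrite Cmod_mult, Cmod_R, Hu, Rabs_pos_eq; lra).
  destruct (Hexp (RtoC r * u)%C ltac:(rewrite Hzr; lra)) as [k [Hh Hk]].
  rewrite Hzr in Hk.
  (* [X] is the error in replacing [u^n k] by [cos t ^ n * an]. The powers differ by at most
     [n |sin t|], as [u - cos t = i sin t], and the coefficients by [L r]. *)
  set (X := (u ^ n * k - RtoC (c ^ n) * an)%C).
  assert (Hc1 : Rabs c <= 1) by (apply Rabs_le; nra).
  assert (Hs1 : Rabs s <= 1) by (apply Rabs_le; nra).
  assert (HkA : Cmod k <= A + L).
  { replace k with (an + (k - an))%C by ring.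
    eapply Rle_trans; [apply Cmod_triangle|]. unfold A. nra. }
  assert (HX : Cmod X <= D * Rabs s + L * r).
  { replace X with ((u ^ n - RtoC c ^ n) * k + RtoC (c ^ n) * (k - an))%C
      by (unfold X; rewrite RtoC_pow; ring).
    eapply Rle_trans; [apply Cmod_triangle|]. rewrite !Cmod_mult, Cmod_R.
    apply Rplus_le_compat.
    - assert (Hp : Cmod (u ^ n - RtoC c ^ n) <= INR n * Rabs s).
      { destruct n as [|m]; [lia|].
        eapply Rle_trans; [apply (Cmod_pow_minus 1)|].
        - lra.
        - rewrite Cmod_R. exact Hc1.
        - rewrite pow1. right.
          replace (u - RtoC c)%C with (RtoC s * Ci)%C
            by (unfold u; apply injective_projections; simpl; ring).
          rewrite Cmod_mult, Cmod_Ci, Cmod_R. ring. }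
      replace (D * Rabs s) with ((INR n * Rabs s) * (A + L)) by (unfold D; ring).
      apply Rmult_le_compat; auto using Cmod_ge_0.
    - rewrite <- RPow_abs.
      pose proof (pow_incr (Rabs c) 1 n (conj (Rabs_pos c) Hc1)) as H1.
      rewrite pow1 in H1. pose proof (pow_le _ n (Rabs_pos c)).
      pose proof (Cmod_ge_0 (k - an)). nra. }
  set (Y := (u ^ n * k)%C).
  assert (HY : Cmod Y <= A + L)
    by (unfold Y; rewrite Cmod_mult, Cmod_pow, Hu, pow1; lra).
  assert (HF : harmonic_of h (circle 0 r t)
               = (r ^ n * Re Y, 2 * r * s + r ^ n * Im Y)).
  { unfold harmonic_of. rewrite Hcirc, Hh, Cpow_mult_l, <- RtoC_pow.
    replace (RtoC (r ^ n) * u ^ n * k)%C with (RtoC (r ^ n) * Y)%C by (unfold Y; ring).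
    unfold u. apply injective_projections; simpl; unfold Re, Im; ring. }
  rewrite HF. change (0 < r ^ n * Re Y * e + (2 * r * s + r ^ n * Im Y) * s).
  assert (HReY : Re Y = Re an * c ^ n + Re X).
  { replace Y with (RtoC (c ^ n) * an + X)%C by (unfold X, Y; ring).
    unfold Re. simpl. ring. }
  set (S' := Rabs s) in *.
  assert (HS' : 0 <= S' <= 1) by (split; [apply Rabs_pos|exact Hs1]).
  assert (HSS : S' * S' = s * s) by (unfold S'; rewrite <- Rabs_mult; apply Rabs_pos_eq; lra).
  assert (HXe : - (D * S' + L * r) <= Re X * e).
  { assert (Rabs (Re X * e) <= D * S' + L * r).
    { rewrite Rabs_mult. pose proof (re_le_Cmod X). pose proof (Rabs_pos e).
      pose proof (Rabs_pos (Re X)). nra. }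
    pose proof (Rle_abs (- (Re X * e))) as Q. rewrite Rabs_Ropp in Q. lra. }
  assert (HYs : - ((A + L) * S') <= Im Y * s).
  { assert (Rabs (Im Y * s) <= (A + L) * S').
    { rewrite Rabs_mult. apply Rmult_le_compat; try apply Rabs_pos; [|unfold S'; lra].
      pose proof (Im_le_Cmod Y). lra. }
    pose proof (Rle_abs (- (Im Y * s))) as Q. rewrite Rabs_Ropp in Q. lra. }
  (* Bernoulli gives [(1 - s^2)^n >= 1 - n s^2], and [s^2 <= |s|]. *)
  assert (Hmain : al - INR n * al * S' <= Re an * c ^ n * e).
  { eapply Rle_trans; [|exact Hdir]. rewrite Hcs.
    pose proof (bernoulli_minus (s * s) n Hs2) as B.
    apply (Rmult_le_compat_l al) in B; [|lra]. fold al.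
    pose proof (Rmult_le_pos _ _ (pos_INR n) (Rlt_le _ _ Hal)).
    assert (INR n * al * (s * s) <= INR n * al * S') by (apply Rmult_le_compat_l; nra).
    lra. }
  set (q := r ^ (n - 1)).
  assert (Hrn : r ^ n = r * q)
    by (unfold q; replace n with (S (n - 1)) at 1 by lia; reflexivity).
  rewrite Hrn.
  (* Here [n >= 2] enters: [r < 1] gives [r^(n-1) <= r]. *)
  assert (Hq : 0 < q <= r).
  { split; [now apply pow_lt|]. unfold q. rewrite <- (pow_1 r) at 2.
    apply pow_le_antitone; [lra|lia]. }
  replace (r * q * Re Y * e + (2 * r * s + r * q * Im Y) * s)
    with (r * (q * (Re Y * e + Im Y * s) + 2 * (s * s))) by ring.
  apply Rmult_lt_0_compat; [exact Hr0|].
  assert (Hlow : al - E * S' - L * r <= Re Y * e + Im Y * s)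
    by (rewrite HReY; unfold E; lra).
  apply (Rmult_le_compat_l q) in Hlow; [|lra].
  (* Expanding [(|s| - q E / 2)^2 >= 0] uses only one of the two available copies of [s^2]. *)
  assert (Hamgm : q * (E * S') <= s * s + q * q * (E * E / 4)).
  { rewrite <- HSS. pose proof (Rle_0_sqr (S' - q * E / 2)) as Q. unfold Rsqr in Q. lra. }
  assert (q * q * (E * E / 4) <= q * r * (E * E / 4))
    by (apply Rmult_le_compat_r; nra).
  assert (0 < q * (al - r * (E * E / 4) - L * r))
    by (apply Rmult_lt_0_compat; [lra|]; unfold K in Hr3; lra).
  lra.
Qed.

(** * From the model direction to the index *)

(** The model vector [(e t, sin t)] need not have unit length: the positive factor [m] relates it to
    [(cos (phi t), sin (phi t))] without changing the sign of the inner product. The hypotheses on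
    [phi] and [e] are what each case of the theorem has to supply. *)
Lemma is_index_of_direction (h : C -> C) (an : C) (n : nat) (rho L : R)
  (phi e : R -> R) (k : Z) :
  0 < rho -> 0 <= L -> (2 <= n)%nat -> Re an <> 0 ->
  (forall z, Cmod z < rho -> continuous h z) ->
  (forall z, 0 < Cmod z < rho -> exists k : C,
      h z = (z + z ^ n * k)%C /\ Cmod (k - an) <= L * Cmod z) ->
  isolated_zero (harmonic_of h) (RtoC 0) ->
  (forall t, continuous phi t) ->
  (forall t, Rabs (e t) <= 1) ->
  (forall t, Rabs (Re an) * (cos t ^ 2) ^ n <= Re an * cos t ^ n * e t) ->
  (forall t, exists m, 0 < m /\ cos (phi t) = m * e t /\ sin (phi t) = m * sin t) ->
  cos (phi 0) = cos (phi (2 * PI)) -> sin (phi 0) = sin (phi (2 * PI)) ->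
  phi (2 * PI) - phi 0 = 2 * PI * IZR k ->
  is_index (harmonic_of h) (RtoC 0) k.
Proof.
  intros Hrho HL Hn Hre Hcont Hexp [_ [rho' [Hrho' Hiso]]] Hphi He Hdir Hm Ec Es Hk.
  destruct (harmonic_direction_positive h an n rho L Hrho HL Hn Hre Hexp)
    as [r0 [Hr0 Hpos]].
  assert (Hfc : forall z, Cmod z < rho -> continuous (harmonic_of h) z).
  { intros z Hz.
    apply (continuous_minus (V := C_R_NormedModule)); [now apply Hcont|].
    apply continuous_C_pair.
    - destruct z. apply continuous_fst.
    - apply (continuous_opp (V := R_NormedModule)). destruct z. apply continuous_snd. }
  (* [rho'] excludes other zeros, while [r0] gives positivity on each circle and, being at most
     [rho], continuity. *)
  exists (Rmin r0 rho'). split; [apply Rmin_pos; lra|]. split.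
  - intros z Hz. pose proof (Rmin_l r0 rho'). pose proof (Rmin_r r0 rho'). split.
    + apply Hfc. replace (z - 0)%C with z in Hz by ring. lra.
    + apply Hiso. lra.
  - intros r Hr.
    assert (Hr' : 0 < r < r0) by (pose proof (Rmin_l r0 rho'); lra).
    replace (IZR k) with (/ (2 * PI) * (phi (2 * PI) - phi 0))
      by (rewrite Hk; field; apply PI_neq0).
    apply is_winding_of_direction; auto.
    + pose proof PI_RGT_0. lra.
    + intros t. apply continuous_circle.
    + intros t. apply Hfc. unfold circle. rewrite Cplus_0_l, Cmod_mult, Cmod_R.
      unfold Cmod. simpl fst. simpl snd.
      replace (cos t ^ 2 + sin t ^ 2) with 1
        by (pose proof (sin2_cos2 t) as Q; unfold Rsqr in Q; simpl; lra).
      rewrite sqrt_1, Rabs_pos_eq; lra.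
    + intros t. destruct (Hm t) as [m [m0 [-> ->]]].
      specialize (Hpos r t (e t) Hr' (He t) (Hdir t)).
      replace (_ + _) with (m * (Re (harmonic_of h (circle 0 r t)) * e t
        + Im (harmonic_of h (circle 0 r t)) * sin t)) by ring.
      now apply Rmult_lt_0_compat.
    + unfold circle. now rewrite cos_2PI, sin_2PI, cos_0, sin_0.
Qed.

Theorem theorem4p2 (h : C -> C) (a : nat -> C) (n : nat)
  (h_exp : has_expansion_at_0 h a)
  (a0 : a 0%nat = RtoC 0)
  (a1 : a 1%nat = RtoC 1)
  (f_isolated : isolated_zero (harmonic_of h) (RtoC 0))
  (f_singular : singular_zero h (RtoC 0))
  (n_ge2 : (2 <= n)%nat)
  (an_neq0 : a n <> RtoC 0)
  (n_min : forall k : nat, (2 <= k < n)%nat -> a k = RtoC 0) :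
  (Re (a n) <> 0 -> Nat.Even n -> is_index (harmonic_of h) (RtoC 0) 0%Z) /\
  (Re (a n) > 0 -> Nat.Odd n -> is_index (harmonic_of h) (RtoC 0) 1%Z) /\
  (Re (a n) < 0 -> Nat.Odd n -> is_index (harmonic_of h) (RtoC 0) (-1)%Z).
Proof.
  destruct (has_expansion_leading_term h a n h_exp a0 a1 n_ge2 n_min)
    as [rho [L [Hrho [HL [Hcont Hexp]]]]].
  pose proof (fun phi e k Hre => is_index_of_direction h (a n) n rho L phi e k
    Hrho HL n_ge2 Hre Hcont Hexp f_isolated) as Hindex.
  assert (Hc2 : forall t, 0 <= cos t ^ 2 <= 1).
  { intros t. pose proof (sin2_cos2 t) as Q. unfold Rsqr in Q. simpl. nra. }
  assert (Hatan : forall t, continuous (fun t => atan (sin t)) t)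
    by (intros t; apply continuous_atan_comp, continuous_sin).
  assert (Hsqrt : forall t, 0 < / sqrt (1 + (sin t)²)).
  { intros t. apply Rinv_0_lt_compat, sqrt_lt_R0. pose proof (Rle_0_sqr (sin t)). lra. }
  (* The right side is [(cos t ^ 2)^(m+1)], and [m + 1 <= n] with base in [[0, 1]]. *)
  assert (Hodd : forall m t, n = (2 * m + 1)%nat -> (cos t ^ 2) ^ n <= cos t ^ n * cos t).
  { intros m t E.
    replace (cos t ^ n * cos t) with ((cos t ^ 2) ^ (m + 1))
      by (rewrite <- pow_mult, E;
          replace (2 * (m + 1))%nat with (2 * m + 1 + 1)%nat by lia; rewrite pow_add; ring).
    apply pow_le_antitone; [apply Hc2|lia]. }
  split; [|split].
  - intros Hre [m Em].
    assert (Heven : forall t, (cos t ^ 2) ^ n <= cos t ^ n).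
    { intros t. rewrite Em at 2. rewrite pow_mult.
      apply pow_le_antitone; [apply Hc2|lia]. }
    destruct (Rlt_or_le 0 (Re (a n))) as [Hpos|Hneg].
    (* Model [(1, sin t)]: it stays in the right half plane, so its angle returns to its initial
       value. *)
    + apply (Hindex (fun t => atan (sin t)) (fun _ => 1)); auto.
      * intros _. rewrite Rabs_R1. lra.
      * intros t. rewrite Rabs_pos_eq by lra. specialize (Heven t). nra.
      * intros t. exists (/ sqrt (1 + (sin t)²)). split; [apply Hsqrt|].
        rewrite cos_atan, sin_atan. split; unfold Rdiv; ring.
      * now rewrite sin_0, sin_2PI.
      * now rewrite sin_0, sin_2PI.
      * rewrite sin_0, sin_2PI. ring.
    (* Model [(-1, sin t)], the mirror image in the left half plane. *)
    + apply (Hindex (fun t => PI - atan (sin t)) (fun _ => -1)); auto.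
      * intros t. apply (continuous_minus (V := R_NormedModule));
          [apply continuous_const|apply Hatan].
      * intros _. rewrite Rabs_left; lra.
      * intros t. rewrite Rabs_left1 by lra. specialize (Heven t). nra.
      * intros t. exists (/ sqrt (1 + (sin t)²)). split; [apply Hsqrt|].
        rewrite Rtrigo_facts.cos_pi_minus, Rtrigo_facts.sin_pi_minus, cos_atan, sin_atan.
        split; unfold Rdiv; ring.
      * now rewrite sin_0, sin_2PI.
      * now rewrite sin_0, sin_2PI.
      * rewrite sin_0, sin_2PI. ring.
  - intros Hre [m Em].
    (* Model [(cos t, sin t)]: one positive turn. *)
    apply (Hindex (fun t => t) cos); try lra.
    + intros t. apply continuous_id.
    + intros t. apply Rabs_le, COS_bound.
    + intros t. rewrite Rabs_pos_eq by lra. specialize (Hodd m t Em). nra.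
    + intros t. exists 1. lra.
    + now rewrite cos_0, cos_2PI.
    + now rewrite sin_0, sin_2PI.
  - intros Hre [m Em].
    (* Model [(- cos t, sin t)]: the reflected circle makes one negative turn. *)
    apply (Hindex (fun t => PI - t) (fun t => - cos t)); try lra.
    + intros t. apply (continuous_minus (V := R_NormedModule));
        [apply continuous_const|apply continuous_id].
    + intros t. rewrite Rabs_Ropp. apply Rabs_le, COS_bound.
    + intros t. rewrite Rabs_left1 by lra. specialize (Hodd m t Em). nra.
    + intros t. exists 1. rewrite Rtrigo_facts.cos_pi_minus, Rtrigo_facts.sin_pi_minus. lra.
    + rewrite !Rtrigo_facts.cos_pi_minus. now rewrite cos_0, cos_2PI.
    + rewrite !Rtrigo_facts.sin_pi_minus. now rewrite sin_0, sin_2PI.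
Qed.
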